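(* There exist absolute constants $c>0$ and $p_0\ge 1$ such that for every integer $p\ge p_0$ and every instance of Budgeted Red-Blue Median, every feasible solution $(R,B)$ that is locally optimum for the $p$-swap heuristic satisfies \[ \mathrm{cost}(R\cup B)\le \Big(5+\frac{c}{\sqrt p}\Big)\cdot OPT, \] where $OPT$ is the minimum cost of a feasible solution. (That is, locally optimum solutions for the $p$-swap heuristic have cost at most $(5+O(1/\sqrt p))\cdot OPT$.)
   Context: Budgeted Red-Blue Median: we are given a finite set $C$ of clients, a finite set $\mathcal R$ of red facilities and a finite set $\mathcal B$ of blue facilities, all located in a metric space with distances $d(i,j)\ge 0$ (symmetric, satisfying the triangle inequality) for all $i,j\in C\cup\mathcal R\cup\mathcal B$, and integers $k_r\le|\mathcal R|$, $k_b\le|\mathcal B|$. A feasible solution is a pair $(R,B)$ with $R\subseteq\mathcal R$, $B\subseteq\mathcal B$, $|R|=k_r$, $|B|=k_b$; its cost is $\mathrm{cost}(R\cup B)=\sum_{j\in C}\min_{i\in R\cup B} d(i,j)$. $OPT$ is the minimum cost over all feasible solutions. For an integer $p\ge1$, a feasible solution $(R,B)$ is locally optimum for the $p$-swap heuristic if there is no feasible solution $(R',B')$ with $|R\setminus R'|\le p$, $|B\setminus B'|\le p$ and $\mathrm{cost}(R'\cup B')<\mathrm{cost}(R\cup B)$. *)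

(* Defs.v *)
From HB Require Import structures.
From mathcomp Require Import all_boot all_order all_algebra.
From mathcomp Require Import reals constructive_ereal.

Set Implicit Arguments.
Unset Strict Implicit.
Unset Printing Implicit Defensive.

Import Order.TTheory GRing.Theory Num.Theory.
Local Open Scope ring_scope.

(* Distinct points may be at distance 0, so co-located clients and facilities
   are allowed; the three sets of points are not required to be disjoint. *)
Record rb_instance (K : realType) := RBInstance {
  point : finType;
  clients : {set point};
  red_fac : {set point};
  blue_fac : {set point};
  dist : point -> point -> K;
  kr : nat;
  kb : nat;
  dist_ge0 : forall i j, 0 <= dist i j;
  dist_refl : forall i, dist i i = 0;
  dist_sym : forall i j, dist i j = dist j i;
  dist_triangle : forall i j k, dist i k <= dist i j + dist j k;
  kr_le : (kr <= #|red_fac|)%N;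
  kb_le : (kb <= #|blue_fac|)%N
}.

Section BudgetedRedBlueMedian.
Variables (K : realType) (I : rb_instance K).
Implicit Types (S R B : {set point I}).

Definition feasible R B : bool :=
  [&& R \subset red_fac I, B \subset blue_fac I,
      #|R| == kr I & #|B| == kb I].

(* The minimum over the empty set (only reached when kr = kb = 0) is +oo. *)
Definition service_cost S (j : point I) : \bar K :=
  \big[Order.min/+oo%E]_(i in S) (dist i j)%:E.

Definition cost S : \bar K := (\sum_(j in clients I) service_cost S j)%E.

(* kr_le and kb_le make this a minimum over a nonempty set. *)
Definition OPT : \bar K :=
  \big[Order.min/+oo%E]_(s : {set point I} * {set point I} | feasible s.1 s.2)
     cost (s.1 :|: s.2).

Definition locally_optimum (p : nat) R B : Prop :=
  ~ exists R' B' : {set point I},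
      [/\ feasible R' B',
          (#|R :\: R'| <= p)%N,
          (#|B :\: B'| <= p)%N
        & (cost (R' :|: B') < cost (R :|: B))%E].

End BudgetedRedBlueMedian.

(* Main.v *)
Require Import Defs.
From HB Require Import structures.
From mathcomp Require Import all_boot all_order all_algebra.
From mathcomp Require Import reals constructive_ereal.
From mathcomp Require Import zify lra.

(**
Let [S] be the local optimum and [O] the optimum, with colour-tagged facilities.
Map every [o] of [O] to its nearest [phi o] in [S], and let [cent s] be the
element of [phi^-1(s)] nearest to [s]. The theorem follows from a weighted family
of colour-balanced swaps (close [A], open [A']) of bounded size in which closing
[s] always opens [cent s]. If client [j] is served by [s] at cost [c] and in the
optimum by [o] at cost [c'], a swap changes its cost by at most
- [c' - c] if [o] is opened,
- [2 c'] if [s] is closed (rerouting [j] to [phi o]),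
- [3 c' + c] if [s] and [phi o] are closed and [o] is not opened (rerouting [j]
  to [cent (phi o)]).
With total weights [x] for opening [o] and [y] for closing [s], it suffices that
[y <= 2] always, and that either [x >= 1] and the third case never happens, or
[x >= 2] and [y <= 1 + 1/q]: in both cases the sum over all swaps is at most
[(5 + 4/q) c' - (1 - 1/q) c].

To build the family, extend [cent s |-> s] to a bijection [rho] from [O] to [S].
Non-centers then correspond to facilities outside the image of [phi], and [rho]
can be chosen so that only blue non-centers are sent to the wrong colour (up to
exchanging the colours). A non-center whose colour is respected is exchanged with
its image with weight 2; everything else is covered about once, by closing
[phi o] together with its remaining non-centers if there are at most [q] of them,
and never closing it otherwise.
*)

Set Implicit Arguments.
Unset Strict Implicit.
Unset Printing Implicit Defensive.

Import Order.TTheory GRing.Theory Num.Theory.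
Local Open Scope ring_scope.

(** * Extending injections, and bounds on finite sums *)

Lemma extend_injection (T1 T2 : finType) (A0 A : {set T1}) (B : {set T2})
    (f : T1 -> T2) :
    A0 \subset A -> {in A0 &, injective f} -> {in A0, forall x, f x \in B} ->
    (#|A| <= #|B|)%N ->
  exists g : T1 -> T2, [/\ {in A0, g =1 f}, {in A &, injective g}
                         & {in A, forall x, g x \in B}].
Proof.
move=> sA fI fB leAB.
pose l1 := enum (A :\: A0); pose l2 := enum (B :\: f @: A0).
have sz : (size l1 <= size l2)%N.
  rewrite -!cardE !cardsD (setIidPr sA) (setIidPr _) ?card_in_imset ?leq_sub2r //.
  by apply/subsetP => y /imsetP [x xA ->]; apply: fB.
(* Elements of [A] outside [A0] are matched by rank with values not taken by [f]; by [sz] the [nth]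
   default is never reached on them. *)
pose g x := if x \in A0 then f x else nth (f x) l2 (index x l1).
have gN x : x \in A -> x \notin A0 -> g x \in B :\: f @: A0.
  move=> xA xA0; rewrite /g (negPf xA0) -mem_enum mem_nth //.
  by apply: leq_trans sz; rewrite index_mem mem_enum inE xA0.
exists g; split.
- by move=> x xA0; rewrite /g xA0.
- move=> x y xA yA.
  have [x0|x0] := boolP (x \in A0); have [y0|y0] := boolP (y \in A0).
  + by rewrite /g x0 y0; apply: fI.
  + move=> gxy; have := gN y yA y0; rewrite -gxy /g x0 inE.
    by rewrite imset_f.
  + move=> gxy; have := gN x xA x0; rewrite gxy /g y0 inE.
    by rewrite imset_f.
  have xl : x \in l1 by rewrite mem_enum inE x0.
  have yl : y \in l1 by rewrite mem_enum inE y0.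
  have ix : (index x l1 < size l2)%N by apply: leq_trans sz; rewrite index_mem.
  have iy : (index y l1 < size l2)%N by apply: leq_trans sz; rewrite index_mem.
  rewrite /g (negPf x0) (negPf y0) (set_nth_default (f x) (f y)) //.
  move/eqP; rewrite nth_uniq ?enum_uniq // => /eqP ixy.
  by rewrite -(nth_index x xl) ixy nth_index.
- move=> x xA; have [x0|x0] := boolP (x \in A0).
    by rewrite /g x0 fB.
  by have := gN x xA x0; rewrite inE => /andP [].
Qed.

Lemma sum_le_unique (K : numDomainType) (I : finType) (P : pred I) (f : I -> K)
    (c : K) (i0 : I) :
  0 <= c -> (forall i, P i -> i = i0) -> (forall i, P i -> f i <= c) ->
  \sum_(i | P i) f i <= c.
Proof.
move=> c0 Pi fc; have [p0|p0] := boolP (P i0).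
  rewrite (big_pred1 i0) ?fc // => i /=.
  by apply/idP/eqP => [/Pi|->].
rewrite big_pred0 // => i; apply/negP => pi.
by move: p0; rewrite -(Pi _ pi) pi.
Qed.

Lemma le_sum_term (K : numDomainType) (I : finType) (P : pred I) (f : I -> K)
    (i0 : I) :
  P i0 -> (forall i, 0 <= f i) -> f i0 <= \sum_(i | P i) f i.
Proof. by move=> p0 f0; rewrite (bigD1 i0) //= lerDl sumr_ge0. Qed.

Lemma le_sum_subpred (K : numDomainType) (I : finType) (P Q : pred I)
    (f g : I -> K) :
  (forall i, P i -> Q i /\ f i <= g i) -> (forall i, Q i -> 0 <= g i) ->
  \sum_(i | P i) f i <= \sum_(i | Q i) g i.
Proof.
move=> PQ g0; rewrite big_mkcond [leRHS]big_mkcond; apply: ler_sum => i _.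
case: ifP => [/PQ [-> //]|_]; case: ifP => // /g0 //.
Qed.

(** * The bijection from the optimum to the local optimum *)

Section Reassignment.
Variables (S O : finType) (cS : S -> bool) (cO : O -> bool).
Variables (phi : O -> S) (cent : S -> O).
Hypothesis phi_cent : forall o, phi (cent (phi o)) = phi o.
Hypothesis card_color :
  forall b, #|[set o | cO o == b]| = #|[set s | cS s == b]|.

(** [cent] is constrained only on the image of [phi], so being a center is tested through
    [phi o]. *)
Definition center o := cent (phi o) == o.

Lemma card_SO : #|O| = #|S|.
Proof.
have cA (T : finType) (c : T -> bool) :
    #|T| = (#|[set x | c x == true]| + #|[set x | c x == false]|)%N.
  rewrite -cardsT -(cardsID [set x | c x == true] setT) setTI; congr addn.
  by apply: eq_card => x; rewrite !inE andbT; case: (c x).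
by rewrite (cA O cO) (cA S cS) !card_color.
Qed.

Lemma phi_center_inj o1 o2 : center o1 -> center o2 -> phi o1 = phi o2 -> o1 = o2.
Proof. by move=> /eqP e1 /eqP e2 e; rewrite -e1 e e2. Qed.

Lemma center_cent o : center (cent (phi o)).
Proof. by rewrite /center phi_cent. Qed.

(** Centers correspond to the image of [phi], so non-centers and facilities missed by [phi] are
    equally many. The blue inequality therefore reverses for red: the red non-centers fit
    injectively into the red missed facilities. The remaining elements are matched arbitrarily. *)
Lemma exists_rho :
    (#|[set s | (s \notin codom phi) && cS s]|
       <= #|[set o | ~~ center o && cO o]|)%N ->
  exists rho : O -> S, [/\ injective rho,
    forall o, center o -> rho o = phi o
  & forall o, ~~ center o -> ~~ cO o -> ~~ cS (rho o)].
Proof.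
move=> leb.
pose C := [set o | center o]; pose Im := [set s in codom phi].
have phiC : phi @: C = Im.
  apply/setP => s; rewrite !inE; apply/imsetP/codomP => [[o _ ->]|[o ->]].
    by exists o.
  by exists (cent (phi o)); rewrite ?phi_cent // inE center_cent.
have phiI : {in C &, injective phi}.
  by move=> x y; rewrite !inE; apply: phi_center_inj.
have cC : #|C| = #|Im| by rewrite -phiC card_in_imset.
pose NR := [set o | ~~ center o && ~~ cO o].
pose ZR := [set s | (s \notin codom phi) && ~~ cS s].
have ler : (#|NR| <= #|ZR|)%N.
  have hO : #|O| = (#|C| + (#|[set o | ~~ center o && cO o]| + #|NR|))%N.
    rewrite -cardsT -(cardsID C setT) setTI; congr addn.
    rewrite -(cardsID [set o | cO o] (setT :\: C)); congr addn.
      by apply: eq_card => x; rewrite !inE andbT.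
    by apply: eq_card => x; rewrite !inE andbT andbC.
  have hS : #|S| = (#|Im| + (#|[set s | (s \notin codom phi) && cS s]| + #|ZR|))%N.
    rewrite -cardsT -(cardsID Im setT) setTI; congr addn.
    rewrite -(cardsID [set o | cS o] (setT :\: Im)); congr addn.
      by apply: eq_card => x; rewrite !inE andbT.
    by apply: eq_card => x; rewrite !inE andbT andbC.
  move: card_SO; rewrite hO hS cC => /addnI.
  by move: leb; lia.
have [||||g [gC gI gB]] := @extend_injection O S C (C :|: NR) (Im :|: ZR) phi.
- exact: subsetUl.
- exact: phiI.
- by move=> x _; rewrite !inE codom_f.
- rewrite cardsU (_ : C :&: NR = set0) ?cards0 ?subn0.
    rewrite cardsU (_ : Im :&: ZR = set0) ?cards0 ?subn0 ?cC ?leq_add2l //.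
    by apply/setP => x; rewrite !inE; case: (x \in codom phi).
  by apply/setP => x; rewrite !inE; case: (center x).
have [||||r [rC rI _]] := @extend_injection O S (C :|: NR) setT setT g => //.
- by rewrite !cardsT card_SO.
exists r; split.
- by move=> x y; apply: rI; rewrite inE.
- by move=> o co; rewrite rC ?gC ?inE ?co.
(* Values in the image of [phi] are used up by centers, so a red non-center lands in [ZR]. *)
move=> o co ro; have oCN : o \in C :|: NR by rewrite !inE co ro orbT.
rewrite rC //; have := gB o oCN; rewrite !inE => /orP [|/andP []//].
case/codomP => o' e'.
have c'C : cent (phi o') \in C by rewrite inE center_cent.
have /gI : g o = g (cent (phi o')) by rewrite (gC _ c'C) phi_cent.
move=> /(_ oCN) oe; move: co; rewrite oe ?center_cent //.
by rewrite inE c'C.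
Qed.

(** * Colour mismatches of [rho] and their pairing *)

Variable rho : O -> S.
Hypothesis rho_inj : injective rho.
Hypothesis rho_center : forall o, center o -> rho o = phi o.
Hypothesis rho_red : forall o, ~~ center o -> ~~ cO o -> ~~ cS (rho o).

(* [true] is blue. A lending [o] is blue with a red image, a borrowing one is red
   with a blue image; [spill] collects the lending non-centers. *)
Definition lend o := cO o && ~~ cS (rho o).
Definition borrow o := ~~ cO o && cS (rho o).
Definition spill o := ~~ center o && lend o.
Definition spills s := [set o | spill o & phi o == s].

Lemma rho_bij : bijective rho.
Proof. by apply: inj_card_bij rho_inj _; rewrite card_SO. Qed.

Lemma borrow_center o : borrow o -> center o.
Proof.
case/andP => ro bo; apply/negPn/negP => co.
by move: (rho_red co ro); rewrite bo.
Qed.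

(** As [rho] is bijective, blue elements and elements with blue image are equally many; those that
    are both are discarded. *)
Lemma card_lend_borrow : #|[set o | lend o]| = #|[set o | borrow o]|.
Proof.
have h : #|[set o | cO o]| = #|[set o | cS (rho o)]|.
  have := card_color true.
  rewrite (_ : [set o | cO o == true] = [set o | cO o]); last first.
    by apply/setP => x; rewrite !inE eqb_id.
  move=> ->; rewrite -(card_imset _ rho_inj); apply: eq_card => s; rewrite !inE.
  rewrite eqb_id; apply/idP/imsetP => [bs|[o]]; last by rewrite inE => ? ->.
  have [r' rK r'K] := rho_bij.
  by exists (r' s); rewrite ?inE r'K.
have h1 := cardsID [set o | cS (rho o)] [set o | cO o].
have h2 := cardsID [set o | cO o] [set o | cS (rho o)].
have e1 : #|[set o | cO o] :\: [set o | cS (rho o)]| = #|[set o | lend o]|.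
  by apply: eq_card => x; rewrite !inE andbC.
have e2 : #|[set o | cS (rho o)] :\: [set o | cO o]| = #|[set o | borrow o]|.
  by apply: eq_card => x; rewrite !inE.
by move: h1 h2; rewrite e1 e2 setIC h; lia.
Qed.

(* [rho \o sigma] respects colours, so a [sigma]-stable set [W] makes a balanced
   swap (close [rho @: W], open [W]). The last clause lets the blue facility
   [phi o] be closed together with its own spills. *)
Lemma exists_sigma : exists sigma : O -> O, [/\ involutive sigma,
    forall o, cS (rho o) = cO (sigma o),
    forall o, ~~ lend o -> ~~ borrow o -> sigma o = o
  & forall o, borrow o -> spills (phi o) != set0 -> sigma o \in spills (phi o)].
Proof.
pose f o := odflt o [pick x in spills (phi o)].
pose E0 := [set o | borrow o && (spills (phi o) != set0)].
have fE o : o \in E0 -> f o \in spills (phi o).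
  rewrite inE /f => /andP [_ /set0Pn [x xs]].
  by case: pickP => [//|/(_ x)]; rewrite xs.
have sl s : {subset spills s <= lend}.
  by move=> x; rewrite inE => /andP [/andP []].
have sp s x : x \in spills s -> phi x = s by rewrite inE => /andP [_ /eqP].
have [||||g [gf gI gD]] := @extend_injection O O E0 [set o | borrow o] [set o | lend o] f.
- by apply/subsetP => x; rewrite !inE => /andP [].
(* Borrowing elements are centers, hence determined by [phi], and a spill remembers its [phi]. *)
- move=> x y xE yE fxy.
  have : phi x = phi y by rewrite -(sp _ _ (fE x xE)) -(sp _ _ (fE y yE)) fxy.
  by move: xE yE; rewrite !inE => /andP [/borrow_center ? _] /andP [/borrow_center ? _]; apply: phi_center_inj.
- by move=> x xE; rewrite inE; apply: sl (fE x xE).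
- by rewrite card_lend_borrow.
have gim : g @: [set o | borrow o] = [set o | lend o].
  apply/eqP; rewrite eqEcard card_in_imset // card_lend_borrow leqnn andbT.
  by apply/subsetP => y /imsetP [x xE ->]; apply: gD.
pose g' y := odflt y [pick x | borrow x & g x == y].
have gK x : borrow x -> g' (g x) = x.
  move=> bx; rewrite /g'; case: pickP => [y /andP [by_ /eqP e]|/(_ x)].
    by apply: gI; rewrite ?inE.
  by rewrite bx eqxx.
have g'P y : lend y -> borrow (g' y) /\ g (g' y) = y.
  move=> ly; have : y \in g @: [set o | borrow o] by rewrite gim inE.
  by case/imsetP => x; rewrite inE => bx ->; rewrite gK.
have bNl x : borrow x -> lend x = false.
  by rewrite /borrow /lend => /andP [/negPf ->].
have lNb x : lend x -> borrow x = false.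
  by rewrite /borrow /lend => /andP [->].
have gl x : borrow x -> lend (g x) by move=> bx; have := gD x; rewrite !inE; apply.
(* Borrowing and lending elements are exchanged along the bijection [g]; all others are fixed. *)
pose sigma o := if borrow o then g o else if lend o then g' o else o.
exists sigma; split.
- move=> o; rewrite /sigma; case bo: (borrow o).
    by rewrite (lNb _ (gl _ bo)) (gl _ bo) gK.
  case lo: (lend o); last by rewrite bo lo.
  by have [-> ->] := g'P _ lo.
- move=> o; rewrite /sigma; case bo: (borrow o).
    by have := gl _ bo; case/andP: bo => _ ->; case/andP => ->.
  case lo: (lend o).
    have [h _] := g'P _ lo.
    by case/andP: h => /negPf ->; case/andP: lo => _ /negPf ->.
  by move: bo lo; rewrite /lend /borrow; case: (cO o); case: (cS (rho o)).
- by move=> o /negPf lo /negPf bo; rewrite /sigma bo lo.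
- move=> o bo so; have oE : o \in E0 by rewrite inE bo.
  by rewrite /sigma bo gf // fE.
Qed.


(** * Hosts of elements and of their [sigma]-partners *)

Variable sigma : O -> O.
Hypothesis sigmaK : involutive sigma.
Hypothesis sigma_color : forall o, cS (rho o) = cO (sigma o).
Hypothesis sigma_id : forall o, ~~ lend o -> ~~ borrow o -> sigma o = o.
Hypothesis sigma_spill :
  forall o, borrow o -> spills (phi o) != set0 -> sigma o \in spills (phi o).

Lemma lend_sigma o : lend o -> borrow (sigma o).
Proof. by rewrite /lend /borrow !sigma_color sigmaK andbC. Qed.

Lemma borrow_sigma o : borrow o -> lend (sigma o).
Proof. by rewrite /lend /borrow !sigma_color sigmaK andbC. Qed.

Lemma phi_spills s k : k \in spills s -> phi k = s.
Proof. by rewrite inE => /andP [_ /eqP]. Qed.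

Lemma spill_spills k : spill k -> k \in spills (phi k).
Proof. by rewrite inE eqxx andbT. Qed.

(* A stuck facility cannot be closed on its own: its bundle below would not be
   balanced, so it is hosted by the bundle of the [sigma]-partner of its center. *)
Definition stuck s := [&& cS s, ~~ cO (cent s) & spills s == set0].

Definition host o := if stuck (phi o) then phi (sigma o) else phi o.

Lemma spill_Nstuck k : spill k -> ~~ stuck (phi k).
Proof.
move=> sk; rewrite /stuck !negb_and; apply/or3P/Or33.
by apply/set0Pn; exists k; apply: spill_spills.
Qed.

Lemma host_phi v : ~~ stuck (phi v) -> host v = phi v.
Proof. by rewrite /host => /negPf ->. Qed.

(* All swaps except the single exchanges touch only elements with one common
   host, so each element is met by the swaps of a single host. *)
Lemma host_sigma v : ~~ stuck (phi v) -> host (sigma v) = phi v.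
Proof.
move=> nst.
have [lv|lv] := boolP (lend v).
  have bo := lend_sigma lv; have co := borrow_center bo.
  (* A stuck [phi (sigma v)] is hosted by [phi v]. Otherwise it has spills, and [sigma_spill] makes
     [v] one of them. *)
  rewrite /host sigmaK; case: ifPn => // nst'.
  have : spills (phi (sigma v)) != set0.
    move: nst'; rewrite /stuck (eqP co) -(rho_center co).
    by case/andP: bo => -> ->.
  by move/(sigma_spill bo); rewrite sigmaK => /phi_spills.
have [bv|bv] := boolP (borrow v); last by rewrite sigma_id // host_phi.
have cv := borrow_center bv.
have : spills (phi v) != set0.
  move: nst; rewrite /stuck (eqP cv) -(rho_center cv).
  by case/andP: bv => -> ->.
by move/(sigma_spill bv)/phi_spills => e; rewrite host_phi e.
Qed.

(** * The swap family: sizes and treatment of centers *)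

Variables (K : realFieldType) (q : nat).
Hypothesis q_gt0 : (0 < q)%N.

(** Non-centers never borrow, so a free element has the colour of its image under [rho]. *)
Definition free o := ~~ center o && ~~ spill o.
Definition big s := (q < #|spills s|)%N.
Definition kernel s := cent s |: spills s.
Definition bundle s := kernel s :|: sigma @: kernel s.
Definition small s := [&& s \in codom phi, ~~ stuck s & ~~ big s].
(** The partner of the center is left out because it moves with the center in every [swap4]. *)
Definition spares s := spills s :\ sigma (cent s).
Definition spare k :=
  [&& spill k, big (phi k) & k != sigma (cent (phi k))].
(* When [s := phi k] has too many spills, its center [e] is opened while [s] stays
   open. A red [s] is replaced by the red facility [rho k] in the closed set. For a
   blue [s], the swap of [k] and [sigma k] is added, but [k] is not opened.
   Averaging over the spares [k] makes the extra closings negligible. *)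
Definition close_big k :=
  [set sigma (cent (phi k))] :\ cent (phi k)
    :|: (if cS (phi k) then [set k; sigma k] else [set k]).
Definition open_big k :=
  [set cent (phi k); sigma (cent (phi k))]
    :|: (if cS (phi k) then [set sigma k] else set0).

(* Weight, preimage under [rho] of the closed set, opened set. *)
Definition swap1 o : K * {set O} * {set O} := (2, [set o], [set o]).
Definition swap2 s : K * {set O} * {set O} := (1, bundle s, bundle s).
Definition swap3 k : K * {set O} * {set O} :=
  (1, [set k; sigma k], [set k; sigma k]).
Definition swap4 k : K * {set O} * {set O} :=
  (#|spares (phi k)|%:R^-1, close_big k, open_big k).
Definition swaps :=
  [seq swap1 o | o <- enum free] ++ [seq swap2 s | s <- enum small]
  ++ [seq swap3 k | k <- enum spare] ++ [seq swap4 k | k <- enum spare].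

Lemma sum_swaps (P : pred (K * {set O} * {set O})) :
  \sum_(t <- swaps | P t) t.1.1 =
    \sum_(o | free o && P (swap1 o)) 2 + (\sum_(s | small s && P (swap2 s)) 1
    + (\sum_(k | spare k && P (swap3 k)) 1
    + \sum_(k | spare k && P (swap4 k)) #|spares (phi k)|%:R^-1)).
Proof. by rewrite !big_cat /= !big_map !big_enum_cond. Qed.

Variant swap_spec : K * {set O} * {set O} -> Prop :=
| Swap1 o of free o : swap_spec (swap1 o)
| Swap2 s of small s : swap_spec (swap2 s)
| Swap3 k of spare k : swap_spec (swap3 k)
| Swap4 k of spare k : swap_spec (swap4 k).

Lemma swapsP t : t \in swaps -> swap_spec t.
Proof.
rewrite !mem_cat.
case/or4P => /mapP [x]; rewrite mem_enum => h ->.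
- exact: Swap1.
- exact: Swap2.
- exact: Swap3.
- exact: Swap4.
Qed.

Lemma spare_spares k : spare k -> k \in spares (phi k).
Proof. by case/and3P => sk _ nk; rewrite !inE nk sk eqxx. Qed.

Lemma spares_spare s k : big s -> k \in spares s -> spare k /\ phi k = s.
Proof.
rewrite in_setD1 => bs /andP [nk ks]; have e := phi_spills ks.
by move: ks; rewrite inE /spare e bs nk => /andP [->].
Qed.

(** The strict inequality in [big] pays for the one spill that may be removed. *)
Lemma leq_card_spares s : big s -> (q <= #|spares s|)%N.
Proof.
rewrite /big (cardsD1 (sigma (cent s))) /spares.
by case: (sigma (cent s) \in spills s); rewrite ?add0n ?add1n ?ltnS // => /ltnW.
Qed.

Lemma spill_Ncenter k : spill k -> ~~ center k.
Proof. by case/andP. Qed.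

Lemma spill_neq_cent k o : spill k -> (k == cent (phi o)) = false.
Proof.
by move=> sk; apply/eqP => e; move: (spill_Ncenter sk); rewrite e center_cent.
Qed.

Lemma kernel_phi s v : s \in codom phi -> v \in kernel s -> phi v = s.
Proof.
case/codomP => o ->; rewrite in_setU1 => /predU1P [->|/phi_spills //].
exact: phi_cent.
Qed.

Lemma host_bundle s o : small s -> o \in bundle s -> host o = s.
Proof.
case/and3P => sc nst _; rewrite inE => /orP [ov|/imsetP [v ov ->]].
  by rewrite host_phi (kernel_phi sc ov).
by rewrite host_sigma (kernel_phi sc ov).
Qed.

Lemma host_spare3 k o : spare k -> o \in [set k; sigma k] -> host o = phi k.
Proof.
case/and3P => /spill_Nstuck nst _ _; rewrite !inE => /orP [] /eqP ->.
  exact: host_phi.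
exact: host_sigma.
Qed.

Lemma host_close_big k o : spare k -> o \in close_big k -> host o = phi k.
Proof.
move=> sk; rewrite inE => /orP [|].
  rewrite !inE => /andP [_ /eqP ->].
  rewrite host_sigma phi_cent //; first by case/and3P: sk => /spill_Nstuck.
move=> h; apply: host_spare3 => //; move: h; case: ifP => // _.
by rewrite !inE => ->.
Qed.

Lemma swaps_ge0 t : t \in swaps -> 0 <= t.1.1.
Proof. by case/swapsP => * /=; rewrite ?ler01 ?ler0n ?invr_ge0 ?ler0n. Qed.

(** A small kernel has at most [q + 1] elements, and its bundle adds their partners; every other
    swap closes at most three facilities. *)
Lemma swaps_card t : t \in swaps -> (#|t.1.2| <= 2 * q.+1)%N.
Proof.
case/swapsP => [o _|s ss|k sk|k sk] /=.
- by rewrite cards1; lia.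
- have kq : (#|kernel s| <= q.+1)%N.
    case/and3P: ss => _ _; rewrite -leqNgt cardsU1 => h.
    by case: (_ \notin _); rewrite ?add1n ?add0n //; apply: leqW.
  apply: leq_trans (leq_card_setU _ _) _; rewrite mul2n -addnn leq_add //.
  exact: leq_trans (leq_imset_card _ _) kq.
- by rewrite cards2; case: (_ != _) => /=; lia.
apply: leq_trans (leq_card_setU _ _) _.
apply: (@leq_trans (1 + 2)%N); last by lia.
apply: leq_add; first by rewrite -(cards1 (sigma (cent (phi k)))) subset_leq_card ?subD1set.
by case: ifP => _; rewrite ?cards1 ?cards2 //; case: (_ != _).
Qed.

(** Only [swap4] closes the image of an element without opening that element, and this element is a
    spill, not a center. Since [rho] maps [cent (phi o)] to [phi o], this makes rerouting to the
    center possible. *)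
Lemma swaps_cent t o : t \in swaps ->
  cent (phi o) \in t.1.2 -> cent (phi o) \in t.2.
Proof.
case/swapsP => // k sk /=; case/and3P: sk => sk _ _.
rewrite !inE => /orP [/andP [_ ->]|]; first by rewrite orbT.
by case: ifP => _; rewrite !inE (eq_sym _ k) (spill_neq_cent _ sk) //= => ->; rewrite !orbT.
Qed.

(** Apart from [swap1], swaps involve only centers, spills and their partners. A partner of a
    lending element is a center, and one of a borrowing element lends, so it is a center or a
    spill. *)
Lemma swaps_free t o : t \in swaps -> free o -> o \in t.1.2 -> t.1.2 = [set o].
Proof.
have bc s : small s -> {in bundle s, forall v, ~~ free v}.
  case/and3P => sc nst _ v; rewrite /free negb_and !negbK.
  have kc w : w \in kernel s -> center w || spill w.
    rewrite in_setU1 => /predU1P [->|]; last by rewrite inE => /andP [->]; rewrite orbT.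
    by case/codomP: sc => w' ->; rewrite center_cent.
  rewrite inE => /orP [/kc //|/imsetP [w wk ->]].
  have [lw|lw] := boolP (lend w); first by rewrite borrow_center ?lend_sigma.
  have [bw|bw] := boolP (borrow w); last by rewrite sigma_id // kc.
  by rewrite /spill borrow_sigma // andbT orbN.
have sf k : spill k -> free k = false by rewrite /free => ->; rewrite andbF.
have bf k : spill k -> free (sigma k) = false.
  by case/andP => _ lk; rewrite /free borrow_center // lend_sigma.
have cf o' : free (sigma (cent (phi o'))) = false.
  rewrite /free /spill.
  have [lw|lw] := boolP (lend (cent (phi o'))); first by rewrite borrow_center ?lend_sigma.
  have [bw|bw] := boolP (borrow (cent (phi o'))); last by rewrite sigma_id // center_cent.
  by rewrite borrow_sigma // andbT andbN.
case/swapsP => [o' _|s ss|k /and3P [sk _ _]|k /and3P [sk _ _]] fo /=.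
- by rewrite inE => /eqP ->.
- by move/(bc _ ss); rewrite fo.
- by rewrite !inE => /orP [] /eqP e; move: fo; rewrite e ?bf ?sf.
rewrite !inE => /orP [/andP [_ /eqP e]|]; first by move: fo; rewrite e cf.
case: ifP => _; rewrite !inE; last by move/eqP => e; move: fo; rewrite e sf.
by move=> /orP [] /eqP e; move: fo; rewrite e ?bf ?sf.
Qed.

(** For a spill [o], only the bundle of [phi o] closes [phi o], and it opens all its spills: a
    [swap3] or [swap4] closing [phi o] would need [k = sigma (cent (phi k))], which [spare]
    excludes. *)
Lemma swaps_Nfree t o : t \in swaps -> ~~ free o ->
  cent (phi o) \in t.1.2 -> o \in t.2.
Proof.
move=> ts; rewrite negb_and !negbK => /orP [/eqP co|so].
  by move/(swaps_cent ts); rewrite co.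
have nst := spill_Nstuck so.
have he : host (cent (phi o)) = phi o by rewrite host_phi phi_cent.
case/swapsP: ts => [o' fo'|s ss|k sk|k sk] /=.
- by rewrite inE => /eqP e; move: fo'; rewrite -e /free center_cent.
- move/(host_bundle ss); rewrite he => <-.
  by rewrite !inE eqxx so orbT.
- move=> h; have := host_spare3 sk h; rewrite he => e; move: h sk.
  rewrite e !inE /spare => h /and3P [sk _]; move: h.
  rewrite eq_sym spill_neq_cent //= => /eqP h.
  by rewrite h sigmaK eqxx.
move=> h; have := host_close_big sk h; rewrite he => e; move: h sk.
rewrite e /close_big !inE /spare => h /and3P [sk _]; move: h; rewrite eqxx /=.
case: ifP => _; rewrite !inE eq_sym spill_neq_cent //= => /eqP h.
by rewrite h sigmaK eqxx.
Qed.


(** * Colour balance of the swaps *)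

Lemma color_le (C A : {set O}) (h : O -> O) :
    {in A &, injective h} -> {in A, forall x, h x \in C} ->
    {in A, forall x, cS (rho (h x)) = cO x} ->
  forall b, (#|[set o in A | cO o == b]|
               <= #|[set s in rho @: C | cS s == b]|)%N.
Proof.
move=> hI hC hc b.
rewrite -(@card_in_imset _ _ h) -1?(card_imset _ rho_inj); last first.
  by move=> x y; rewrite !inE => /andP [xA _] /andP [yA _]; apply: hI.
apply/subset_leq_card/subsetP => y /imsetP [x /imsetP [o]].
rewrite inE => /andP [oA ob] -> ->.
by rewrite inE imset_f ?hC //= hc.
Qed.

Lemma swaps_color t b : t \in swaps ->
  (#|[set o in t.2 | cO o == b]| <= #|[set s in rho @: t.1.2 | cS s == b]|)%N.
Proof.
have sI : injective sigma := inv_inj sigmaK.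
case/swapsP => [o fo|s ss|k sk|k sk] /=.
- apply: (@color_le _ _ id) => // x; rewrite inE => /eqP ->.
  case/andP: fo => co; rewrite /spill co /= negb_and negbK.
  by case: (cO o) (rho_red co) => //= /(_ isT) /negPf.
- apply: (@color_le _ _ sigma) => [x y _ _ /sI //|x|x _]; last by rewrite sigma_color sigmaK.
  rewrite in_setU => /orP [xk|/imsetP [y yk ->]]; last by rewrite sigmaK inE yk.
  by rewrite inE imset_f ?orbT.
- apply: (@color_le _ _ sigma) => [x y _ _ /sI //|x|x _]; last by rewrite sigma_color sigmaK.
  by rewrite !inE => /orP [] /eqP ->; rewrite ?sigmaK eqxx ?orbT.
case/and3P: sk => sk _ nk; set e := cent (phi k) in nk *.
have ke : (k == e) = false by apply: spill_neq_cent.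
have [lk ck] : lend k /\ ~~ center k by case/andP: sk.
have bk := lend_sigma lk.
have ksk : (k == sigma k) = false.
  apply/eqP => e'; move: lk bk; rewrite -e' /lend /borrow => /andP [->] //.
have kse := negPf nk.
have ske : (sigma k == e) = false by rewrite (can2_eq sigmaK sigmaK).
have skse : (sigma k == sigma e) = false by rewrite (inj_eq sI).
have cse : cO (sigma e) = cS (phi k).
  by rewrite -sigma_color rho_center ?center_cent // phi_cent.
(* In [swap4] the partner [e] of [sigma e] is not closed. Its substitute [k'] has an image of the
   colour of [phi k], which is the colour of [sigma e]. *)
pose k' := if cS (phi k) then sigma k else k.
have k'N x : x \in open_big k -> (sigma x == k') = false.
  rewrite /open_big /k' -/e; case: ifP => _; rewrite !inE ?orbF.
    rewrite (inj_eq sI) => h; apply/eqP => xk; move: h; rewrite xk ke kse ksk.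
    by [].
  by move=> /orP [] /eqP ->; rewrite ?sigmaK eq_sym.
pose h x := if x == sigma e then k' else sigma x.
apply: (@color_le _ _ h) => [x y xA yA|x|x _]; rewrite /h.
- case: eqP => [->|_]; case: eqP => [->|_] // /eqP; last by rewrite (inj_eq sI) => /eqP.
    by rewrite eq_sym k'N.
  by rewrite k'N.
- rewrite /open_big /close_big /k' -/e.
  case: eqP => [_ _|/eqP xse]; first by case: ifP; rewrite !inE eqxx ?orbT.
  rewrite in_setU in_set2 (negPf xse) orbF => /orP [/eqP xe|].
    by move: xse; rewrite xe !inE eqxx andbT (eq_sym e) => ->.
  by case: ifP; rewrite !inE // => _ /eqP ->; rewrite sigmaK eqxx orbT.
case: eqP => [->|_]; last by rewrite sigma_color sigmaK.
rewrite cse /k'; case: (cS (phi k)); last by case/andP: lk => _ /negPf.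
by case/andP: bk.
Qed.

(** * Opening and closing weights *)

Lemma free_opened o : free o -> 2 <= \sum_(t <- swaps | o \in t.2) t.1.1.
Proof.
move=> fo; rewrite sum_swaps.
rewrite -[leLHS]addr0; apply: lerD; last first.
  by rewrite !addr_ge0 ?sumr_ge0 // => k _; rewrite invr_ge0.
by apply: (@le_sum_term _ _ _ (fun=> 2) o) => //=; rewrite fo set11.
Qed.

(** If [phi o] is stuck, the partner of [o] decides. A small host opens [o] in its bundle, and a
    spare opens it in its [swap3]. Otherwise [o] is the center of a big host or the partner of that
    center, and is opened by every [swap4] there, with total weight 1. *)
Lemma Nfree_opened o : ~~ free o -> 1 <= \sum_(t <- swaps | o \in t.2) t.1.1.
Proof.
move=> fo; rewrite sum_swaps.
set x1 := \sum_(_ | _) _; set x2 := \sum_(_ | _) _; set x3 := \sum_(_ | _) _.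
set x4 := \sum_(_ | _) _.
have x1_ge0 : 0 <= x1 by apply: sumr_ge0.
have x2_ge0 : 0 <= x2 by apply: sumr_ge0.
have x3_ge0 : 0 <= x3 by apply: sumr_ge0.
have x4_ge0 : 0 <= x4 by apply: sumr_ge0 => k _; rewrite invr_ge0.
suff : [|| 1 <= x2, 1 <= x3 | 1 <= x4] by case/or3P => h; lra.
pose v := if stuck (phi o) then sigma o else o.
have ov : o = v \/ o = sigma v by rewrite /v; case: ifP => _; [right; rewrite sigmaK | left].
have [nst cv] : ~~ stuck (phi v) /\ (center v || spill v).
  rewrite /v; case: ifPn => [st|nst]; last by split=> //; move: fo; rewrite negb_and !negbK.
  have co : center o.
    move: fo; rewrite negb_and !negbK => /orP [//|/spill_Nstuck]; by rewrite st.
  have bo : borrow o.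
    by case/and3P: st; rewrite (eqP co) -(rho_center co) /borrow => -> ->.
  have lo := borrow_sigma bo.
  have [cs|cs] := boolP (center (sigma o)); last first.
    by rewrite /spill cs lo; split=> //; apply: spill_Nstuck; rewrite /spill cs lo.
  by split=> //; rewrite /stuck -(rho_center cs); case/andP: lo => _ /negPf ->.
have vk : v \in kernel (phi v).
  rewrite in_setU1; case/orP: cv => [/eqP ->|/spill_spills ->]; by rewrite ?eqxx ?orbT.
have [bv|bv] := boolP (big (phi v)); last first.
  apply/or3P/Or31; apply: (@le_sum_term _ _ _ (fun=> 1) (phi v)) => //=.
  rewrite /small codom_f nst bv /= inE.
  by case: ov => ->; rewrite ?vk ?imset_f ?orbT.
have [sv|nsv] := boolP (spare v).
  apply/or3P/Or32; apply: (@le_sum_term _ _ _ (fun=> 1) v) => //=.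
  by rewrite sv !inE; case: ov => ->; rewrite eqxx ?orbT.
apply/or3P/Or33.
have -> : 1 = \sum_(k in spares (phi v)) #|spares (phi v)|%:R^-1 :> K.
  rewrite sumr_const -(mulr_natr _^-1) mulVf // pnatr_eq0 -lt0n.
  by apply: leq_trans (leq_card_spares bv).
apply: le_sum_subpred => k; last by rewrite invr_ge0.
move=> /(spares_spare bv) [sk e]; rewrite e sk; split=> //=.
rewrite !inE e.
suff : (o == cent (phi v)) || (o == sigma (cent (phi v))) by move=> ->.
case/orP: cv => [/eqP cv|sv].
  by rewrite cv; case: ov => ->; rewrite eqxx ?orbT.
move: nsv; rewrite /spare sv bv /= negbK => /eqP ve.
by case: ov => ->; rewrite {1 3}ve ?sigmaK eqxx ?orbT.
Qed.

Lemma free_closed o : free o -> \sum_(t <- swaps | o \in t.1.2) t.1.1 <= 2.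
Proof.
move=> fo.
have nf t x : t \in swaps -> o \in t.1.2 -> x \in t.1.2 -> x = o.
  by move=> ts /(swaps_free ts fo) ->; rewrite inE => /eqP.
have mem3 k : spare k -> swap3 k \in swaps.
  by move=> sk; rewrite !mem_cat (map_f swap3) ?orbT ?mem_enum.
have mem4 k : spare k -> swap4 k \in swaps.
  by move=> sk; rewrite !mem_cat (map_f swap4) ?orbT ?mem_enum.
rewrite sum_swaps [X in _ + (X + _)]big_pred0 ?add0r => [|s]; last first.
  apply/andP => -[ss os].
  have s2 : swap2 s \in swaps by rewrite !mem_cat (map_f swap2) ?orbT ?mem_enum.
  have /(nf _ _ s2 os) e : cent s \in (swap2 s).1.2 by rewrite /= !inE eqxx.
  case/and3P: ss => /codomP [o' es] _ _.
  by case/andP: fo; rewrite -e es center_cent.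
rewrite [X in _ + (X + _)]big_pred0 ?add0r => [|k]; last first.
  apply/andP => -[sk ok].
  have /(nf _ _ (mem3 k sk) ok) e : k \in (swap3 k).1.2 by rewrite /= !inE eqxx.
  by case/andP: fo => _; rewrite -e; case/and3P: sk => ->.
rewrite [X in _ + X]big_pred0 ?addr0 => [|k]; last first.
  apply/andP => -[sk ok].
  have /(nf _ _ (mem4 k sk) ok) e : k \in (swap4 k).1.2.
    by rewrite /= /close_big; case: ifP; rewrite !inE eqxx ?orbT.
  by case/andP: fo => _; rewrite -e; case/and3P: sk => ->.
by apply: (@sum_le_unique _ _ _ _ _ o) => // o' /andP [_]; rewrite inE => /eqP.
Qed.

(** All swaps closing [o] belong to one host. If it is not big, only its bundle counts. If it is
    big, either [o] is the partner of the center, closed by the [swap4] family alone with total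
    weight 1, or a single spare matters, with weight 1 in [swap3] and at most [1/q] in [swap4]. *)
Lemma Nfree_closed o : ~~ free o ->
  \sum_(t <- swaps | o \in t.1.2) t.1.1 <= 1 + q%:R^-1.
Proof.
move=> fo; rewrite sum_swaps.
have q_ge0 : 0 <= q%:R^-1 :> K by rewrite invr_ge0.
rewrite big_pred0 ?add0r; last first.
  by move=> o'; rewrite /= inE; apply/andP => -[fo' /eqP e]; move: fo; rewrite e fo'.
have [bh|bh] := boolP (big (host o)); last first.
  rewrite [X in _ + (X + _)]big_pred0 => [|k]; last first.
    apply/andP => -[sk /(host_spare3 sk) e].
    by case/and3P: sk => _; rewrite -e (negPf bh).
  rewrite [X in _ + (_ + X)]big_pred0 => [|k]; last first.
    apply/andP => -[sk /(host_close_big sk) e].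
    by case/and3P: sk => _; rewrite -e (negPf bh).
  rewrite !addr0; apply: (@sum_le_unique _ _ _ _ _ (host o)) => [|s /andP [ss]|s _].
  - by rewrite addr_ge0.
  - by move/(host_bundle ss).
  - by rewrite lerDl.
rewrite big_pred0 ?add0r => [|s]; last first.
  apply/andP => -[ss /(host_bundle ss) e].
  by case/and3P: ss => _ _; rewrite -e bh.
set e := cent (host o).
have [/andP [oe one]|no] := boolP ((o == sigma e) && (o != e)).
  rewrite [X in X + _]big_pred0 => [|k]; last first.
    apply/andP => -[sk ok]; have ek := host_spare3 sk ok.
    case/and3P: sk; rewrite -ek -/e => sk _ nk; move: ok => /=; rewrite !inE => /orP [] /eqP ok.
      by move: nk; rewrite -ok oe.
    by move: oe; rewrite ok (inj_eq (inv_inj sigmaK)) /e ek spill_neq_cent.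
  rewrite add0r (@le_trans _ _ 1) ?lerDl //.
  apply: (@le_trans _ _ (\sum_(k in spares (host o)) #|spares (host o)|%:R^-1)).
    apply: le_sum_subpred => [k /andP [sk ok]|k _]; last by rewrite invr_ge0.
    by have ek := host_close_big sk ok; rewrite ek (spare_spares sk).
  rewrite sumr_const -(mulr_natr _^-1) mulVf // pnatr_eq0 -lt0n.
  by apply: leq_trans (leq_card_spares bh).
(* The partner of a spill borrows and so is a center; hence [o] determines the spill [k]. *)
pose k0 := if spill o then o else sigma o.
have k0P k : spill k -> o \in [set k; sigma k] -> k = k0.
  move=> sk; rewrite /k0 !inE => /orP [] /eqP ok; first by rewrite ok sk.
  have : spill o = false.
    rewrite ok; apply/negbTE; rewrite /spill negb_and negbK; apply/orP; left.
    by apply/borrow_center/lend_sigma; case/andP: sk.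
  by move=> ->; rewrite ok sigmaK.
apply: lerD; apply: (@sum_le_unique _ _ _ _ _ k0) => //.
- by move=> k /andP [/and3P [sk _ _]]; apply: k0P.
- move=> k /andP [sk ok]; have ek := host_close_big sk ok; case/and3P: sk => sk _ _.
  apply: k0P => //; move: ok => /=; rewrite /close_big -ek -/e !inE.
  rewrite andbC (negPf no) /=.
  by case: ifP => _; rewrite !inE // => ->.
- move=> k /andP [/and3P [_ bk _] _].
  by rewrite lef_pV2 ?posrE ?ltr0n ?ler_nat ?leq_card_spares // (leq_trans q_gt0) ?leq_card_spares.
Qed.

(** * Transport of the swaps along [rho], and symmetry of the colours *)

Lemma weighted_swaps_rho_sigma :
  exists sw : seq (K * {set S} * {set O}),
  [/\ forall t, t \in sw -> [/\ 0 <= t.1.1, (#|t.1.2| <= 2 * q.+1)%N,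
         forall b, (#|[set o in t.2 | cO o == b]|
                      <= #|[set s in t.1.2 | cS s == b]|)%N
       & forall o, phi o \in t.1.2 -> cent (phi o) \in t.2],
      forall s, \sum_(t <- sw | s \in t.1.2) t.1.1 <= 2
    & forall o s,
        (1 <= \sum_(t <- sw | o \in t.2) t.1.1 /\
         forall t, t \in sw -> s \in t.1.2 -> phi o \in t.1.2 -> o \in t.2) \/
        (2 <= \sum_(t <- sw | o \in t.2) t.1.1 /\
         \sum_(t <- sw | s \in t.1.2) t.1.1 <= 1 + q%:R^-1)].
Proof.
pose im (t : K * {set O} * {set O}) := (t.1.1, rho @: t.1.2, t.2).
have [r' rK r'K] := rho_bij.
have memr (C : {set O}) s : (s \in rho @: C) = (r' s \in C).
  by rewrite -{1}(r'K s) mem_imset.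
have r'phi o : r' (phi o) = cent (phi o).
  by rewrite -{1}phi_cent -rho_center ?center_cent ?rK.
have q1 : q%:R^-1 <= 1 :> K by rewrite invf_le1 ?ler1n ?ltr0n.
have y2 s : \sum_(t <- swaps | r' s \in t.1.2) t.1.1 <= 2.
  have [f|/Nfree_closed h] := boolP (free (r' s)); first exact: free_closed.
  by apply: le_trans h _; lra.
exists (map im swaps); split.
- move=> _ /mapP [t ts ->]; split => /=.
  + exact: swaps_ge0.
  + exact: leq_trans (leq_imset_card _ _) (swaps_card ts).
  + by move=> b; apply: swaps_color.
  + by move=> o; rewrite memr r'phi; apply: swaps_cent.
- move=> s; rewrite big_map /=; under eq_bigl do rewrite memr.
  exact: y2.
move=> o s; rewrite !big_map /=.
(* The second alternative serves a free [o] with a non-free preimage of [s]. If both are free, a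
   swap closing [s] closes nothing else, and [phi o], whose preimage is a center, stays open. *)
have [fo|fo] := boolP (free o); last first.
  left; split; first exact: Nfree_opened.
  move=> _ /mapP [t ts ->] /= _; rewrite memr r'phi.
  exact: swaps_Nfree.
have [fs|fs] := boolP (free (r' s)); last first.
  right; split; first exact: free_opened.
  under eq_bigl do rewrite memr; exact: Nfree_closed.
left; split; first by apply: le_trans (free_opened fo); lra.
move=> _ /mapP [t ts ->] /=; rewrite !memr r'phi => /(swaps_free ts fs) ->.
by rewrite inE => /eqP e; move: fs; rewrite -e /free center_cent.
Qed.

End Reassignment.

(** Non-centers and facilities missed by [phi] are equally many, so the inequality required by
    [exists_rho] holds for one of the two colours; negating both colourings exchanges them. *)
Lemma weighted_swaps (K : realFieldType) (S O : finType) (cS : S -> bool)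
    (cO : O -> bool) (phi : O -> S) (cent : S -> O) (q : nat) :
    (forall o, phi (cent (phi o)) = phi o) ->
    (forall b, #|[set o | cO o == b]| = #|[set s | cS s == b]|) ->
    (0 < q)%N ->
  exists sw : seq (K * {set S} * {set O}),
  [/\ forall t, t \in sw -> [/\ 0 <= t.1.1, (#|t.1.2| <= 2 * q.+1)%N,
         forall b, (#|[set o in t.2 | cO o == b]|
                      <= #|[set s in t.1.2 | cS s == b]|)%N
       & forall o, phi o \in t.1.2 -> cent (phi o) \in t.2],
      forall s, \sum_(t <- sw | s \in t.1.2) t.1.1 <= 2
    & forall o s,
        (1 <= \sum_(t <- sw | o \in t.2) t.1.1 /\
         forall t, t \in sw -> s \in t.1.2 -> phi o \in t.1.2 -> o \in t.2) \/
        (2 <= \sum_(t <- sw | o \in t.2) t.1.1 /\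
         \sum_(t <- sw | s \in t.1.2) t.1.1 <= 1 + q%:R^-1)].
Proof.
move=> phi_cent.
wlog leb : cS cO / (#|[set s | (s \notin codom phi) && cS s]|
                     <= #|[set o | ~~ center phi cent o && cO o]|)%N.
  move=> hw cc q0.
  have [/hw|lt] := leqP #|[set s | (s \notin codom phi) && cS s]|
                        #|[set o | ~~ center phi cent o && cO o]|; first exact.
  have eqN (T : finType) (c : T -> bool) b : [set x | ~~ c x == b] = [set x | c x == ~~ b].
    by apply/setP => x; rewrite !inE; case: (c x); case: b.
  have eqNi (T : finType) (A : {set T}) (c : T -> bool) b :
      [set x in A | ~~ c x == b] = [set x in A | c x == ~~ b].
    by apply/setP => x; rewrite !inE; case: (c x); case: b.
  have [||//|sw [h1 h2 h3]] := hw (fun s => ~~ cS s) (fun o => ~~ cO o).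
  - have cnt (T : finType) (a c : pred T) :
        (#|[set x | a x && c x]| + #|[set x | a x && ~~ c x]|)%N = #|[set x | a x]|.
      rewrite -(cardsID [set x | c x] [set x | a x]); congr addn.
        by apply: eq_card => x; rewrite !inE.
      by apply: eq_card => x; rewrite !inE andbC.
    have := cnt _ (fun s => s \notin codom phi) cS.
    have := cnt _ (fun o => ~~ center phi cent o) cO.
    suff -> : #|[set x | ~~ center phi cent x]| = #|[set s | s \notin codom phi]|.
      by move: lt => /=; lia.
    have hO := cardsC [set x | center phi cent x].
    have hS := cardsC [set s in codom phi].
    have e : #|[set x | center phi cent x]| = #|[set s in codom phi]|.
      rewrite -(@card_in_imset _ _ phi); last first.
        by move=> x y; rewrite !inE; apply: phi_center_inj.
      apply: eq_card => s; rewrite !inE; apply/imsetP/codomP => [[o _ ->]|[o ->]].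
        by exists o.
      by exists (cent (phi o)); rewrite ?phi_cent // inE center_cent.
    have eO : ~: [set x | center phi cent x] = [set x | ~~ center phi cent x].
      by apply/setP => x; rewrite !inE.
    have eS : ~: [set s in codom phi] = [set s | s \notin codom phi].
      by apply/setP => x; rewrite !inE.
    by move: hO hS (card_SO cc); rewrite e eO eS; lia.
  - by move=> b; rewrite !eqN.
  exists sw; split=> // t /h1 [? ? h ?]; split=> // b.
  by have := h (~~ b); rewrite !eqNi negbK.
move=> cc q0.
have [rho [rI rC rR]] := exists_rho phi_cent cc leb.
have [sigma [sK sc sid ss]] := exists_sigma cc rI rR.
exact: (@weighted_swaps_rho_sigma _ _ _ _ _ _ phi_cent cc rho).
Qed.

(** * Rerouting clients and summing over the swaps *)

Section CostBound.
Variables (K : realFieldType) (T S O : finType) (d : T -> T -> K).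
Hypothesis d_ge0 : forall i j, 0 <= d i j.
Hypothesis d_sym : forall i j, d i j = d j i.
Hypothesis d_tri : forall i j k, d i k <= d i j + d j k.
Variables (pS : S -> T) (pO : O -> T) (cS : S -> bool) (cO : O -> bool).
Hypothesis card_color :
  forall b, #|[set o | cO o == b]| = #|[set s | cS s == b]|.
Variables (clients : {set T}) (sv : T -> S) (op : T -> O) (q : nat).
Hypothesis q_gt0 : (0 < q)%N.
Hypothesis local_opt : forall (A : {set S}) (A' : {set O}) (f : T -> T),
  (#|A| <= 2 * q.+1)%N ->
  (forall b, (#|[set o in A' | cO o == b]| <= #|[set s in A | cS s == b]|)%N) ->
  (forall j, f j \in pS @: (~: A) :|: pO @: A') ->
  \sum_(j in clients) d (pS (sv j)) j <= \sum_(j in clients) d (f j) j.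

Lemma local_opt_cost :
  (1 - q%:R^-1) * \sum_(j in clients) d (pS (sv j)) j
    <= (5 + 4 * q%:R^-1) * \sum_(j in clients) d (pO (op j)) j.
Proof.
(* The client [j0] only supplies default elements of [S] and [O] for the minimizers. *)
have [->|/set0Pn [j0 _]] := eqVneq clients set0; first by rewrite !big_set0 !mulr0.
pose phi o := [arg min_(s < sv j0) d (pS s) (pO o)]%O.
have phiP o s : d (pS (phi o)) (pO o) <= d (pS s) (pO o).
  by rewrite /phi; case: arg_minP => // i _; apply.
pose cent s := if [pick o | phi o == s] is Some o1 then
  [arg min_(o < o1 | phi o == s) d (pS s) (pO o)]%O else op j0.
have centP o : phi (cent (phi o)) = phi o /\
    d (pS (phi o)) (pO (cent (phi o))) <= d (pS (phi o)) (pO o).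
  rewrite /cent; case: pickP => [o1 h|/(_ o)]; last by rewrite eqxx.
  by case: arg_minP => // i /eqP pi le_i; split=> //; apply: le_i.
have [sw [hsw hy hxy]] := @weighted_swaps K S O cS cO phi cent q
  (fun o => (centP o).1) card_color q_gt0.
set e := q%:R^-1; have e0 : 0 <= e by rewrite invr_ge0.
pose c j := d (pS (sv j)) j; pose c' j := d (pO (op j)) j.
have cge j : 0 <= c j by apply: d_ge0.
have c'ge j : 0 <= c' j by apply: d_ge0.
pose bad (t : K * {set S} * {set O}) j :=
  [&& sv j \in t.1.2, phi (op j) \in t.1.2 & op j \notin t.2].
pose f (t : K * {set S} * {set O}) j :=
  if (op j \in t.2) && ((c' j <= c j) || (sv j \in t.1.2)) then pO (op j)
  else if sv j \notin t.1.2 then pS (sv j)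
  else if phi (op j) \notin t.1.2 then pS (phi (op j))
  else pO (cent (phi (op j))).
(* Under [f] a client keeps an open [sv j] when [op j] is farther. So opening [op j] contributes a
   nonpositive term, and lower bounds on its weight can be used. *)
pose m j := Num.min 0 (c' j - c j).
have m0 j : m j <= 0 by rewrite ge_min lexx.
have mneg j : c' j <= c j -> m j = c' j - c j.
  by move=> h; rewrite /m min_r // subr_le0.
have mpos j : c j <= c' j -> m j = 0.
  by move=> h; rewrite /m min_l // subr_ge0.
have mc j : m j <= c' j - c j by rewrite ge_min lexx orbT.
pose delta (t : K * {set S} * {set O}) j :=
  (op j \in t.2)%:R * m j + (sv j \in t.1.2)%:R * (2 * c' j)
    + (bad t j)%:R * (c' j + c j).
have fd t j : d (f t j) j - c j <= delta t j.
  have c0 := cge j; have c'0 := c'ge j; have := mc j; have := m0 j.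
  have h1 : d (pS (phi (op j))) (pO (op j)) <= c' j + c j.
    apply: le_trans (phiP _ (sv j)) _; apply: le_trans (d_tri _ j _) _.
    by rewrite addrC /c /c' (d_sym j).
  have h2 : d (pS (phi (op j))) j <= 2 * c' j + c j.
    by apply: le_trans (d_tri _ (pO (op j)) _) _; move: h1; rewrite /c' /c; lra.
  have h3 : d (pO (cent (phi (op j)))) j <= 3 * c' j + 2 * c j.
    apply: le_trans (d_tri _ (pS (phi (op j))) _) _.
    by move: h1 h2 (centP (op j)).2; rewrite (d_sym (pO (cent _))); lra.
  rewrite /delta /bad /f.
  case: (leP (c' j) (c j)) => h; [rewrite (mneg _ h)|rewrite (mpos _ (ltW h))];
    case: (op j \in t.2); case: (sv j \in t.1.2); case: (phi (op j) \in t.1.2);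
    rewrite /= -/(c j) -/(c' j); lra.
have sum_bound j : \sum_(t <- sw) t.1.1 * delta t j
    <= (5 + 4 * e) * c' j - (1 - e) * c j.
  set x := \sum_(t <- sw | op j \in t.2) t.1.1.
  set y := \sum_(t <- sw | sv j \in t.1.2) t.1.1.
  set z := \sum_(t <- sw | bad t j) t.1.1.
  have -> : \sum_(t <- sw) t.1.1 * delta t j
      = x * m j + y * (2 * c' j) + z * (c' j + c j).
    have ind (P : pred (K * {set S} * {set O})) k :
        (\sum_(t <- sw | P t) t.1.1) * k = \sum_(t <- sw) t.1.1 * ((P t)%:R * k).
      rewrite big_mkcond mulr_suml; apply: eq_bigr => t _.
      by case: (P t); rewrite ?mul1r ?mul0r ?mulr0.
    rewrite !ind -!big_split /=; apply: eq_bigr => t _.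
    by rewrite /delta !mulrDr.
  have zy : z <= y.
    rewrite /z /y big_mkcond [leRHS]big_mkcond big_seq [leRHS]big_seq.
    apply: ler_sum => t /hsw [w0 _ _ _]; rewrite /bad.
    by case: (sv j \in _) => //=; case: ifP.
  have c0 := cge j; have c'0 := c'ge j; have m0j := m0 j; have mcj := mc j.
  have ec : 0 <= e * c j by apply: mulr_ge0.
  have ec' : 0 <= e * c' j by apply: mulr_ge0.
  have y2 : y <= 2 by apply: hy.
  have cc0 : 0 <= c' j + c j by lra.
  have [[x1 nb]|[x2 y1]] := hxy (op j) (sv j).
    have -> : z = 0.
      rewrite /z big1_seq // => t /andP [/and3P [h1 h2 /negP h3] ts].
      by case: h3; apply: nb.
    have xm : x * m j <= m j by rewrite -[leRHS]mul1r; apply: ler_wnM2r.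
    have yc : y * (2 * c' j) <= 2 * (2 * c' j) by apply: ler_wpM2r => //; lra.
    lra.
  (* Here the three terms add up to at most [(5 + 3 * e) * c' j - (1 - e) * c j]. *)
  have xm : x * m j <= 2 * m j by apply: ler_wnM2r.
  have yc : y * (2 * c' j) <= (1 + e) * (2 * c' j) by apply: ler_wpM2r => //; lra.
  have zc : z * (c' j + c j) <= (1 + e) * (c' j + c j).
    by apply: ler_wpM2r => //; apply: le_trans zy y1.
  lra.
have swap_ge0 : 0 <= \sum_(t <- sw) t.1.1 * \sum_(j in clients) (d (f t j) j - c j).
  rewrite big_seq; apply: sumr_ge0 => t ts; have [w0 hc hb hcent] := hsw t ts.
  apply: mulr_ge0 => //; rewrite sumrB subr_ge0; apply: (local_opt hc hb) => j.
  rewrite /f inE; case: ifPn => [/andP [h _]|_]; first by rewrite imset_f ?orbT.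
  case: ifPn => [h|_]; first by rewrite imset_f ?inE.
  case: ifPn => [h|/negPn h]; first by rewrite imset_f ?inE.
  by rewrite orbC imset_f ?hcent.
have : 0 <= \sum_(j in clients) ((5 + 4 * e) * c' j - (1 - e) * c j).
  apply: le_trans swap_ge0 _.
  under eq_bigr do rewrite mulr_sumr; rewrite exchange_big /=.
  apply: ler_sum => j _; apply: le_trans (sum_bound j).
  rewrite big_seq [leRHS]big_seq; apply: ler_sum => t ts.
  by apply: ler_wpM2l; [have [] := hsw t ts | apply: fd].
by rewrite sumrB -!mulr_sumr subr_ge0.
Qed.

End CostBound.

(** * Completing a swap to the prescribed cardinality *)

Lemma subset_of_card (T : finType) (A C : {set T}) (n : nat) :
    A \subset C -> (#|A| <= n <= #|C|)%N ->
  exists B : {set T}, [/\ A \subset B, B \subset C & #|B| = n].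
Proof.
move=> sAC /andP [An nC].
pose X := [set x in take (n - #|A|) (enum (C :\: A))].
have sX : {subset X <= C :\: A}.
  by move=> x; rewrite inE => /mem_take; rewrite mem_enum.
exists (A :|: X); split.
- exact: subsetUl.
- by rewrite subUset sAC; apply/subsetP => x /sX; rewrite inE => /andP [].
rewrite cardsU (_ : A :&: X = set0) ?cards0 ?subn0; last first.
  apply/setP => x; rewrite !inE; apply/andP => -[xA].
  by move/mem_take; rewrite mem_enum inE xA.
rewrite cardsE (card_uniqP _) ?take_uniq ?enum_uniq // size_takel ?subnKC //.
by rewrite -cardE cardsD (setIidPr sAC) leq_sub2r.
Qed.

(** The set [(R :\: X) :|: Y] has at most [#|R|] elements and is filled up inside [C]; only elements
    of [X] can leave [R]. *)
Lemma exchange_set (T : finType) (C R X Y : {set T}) :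
    R \subset C -> X \subset R -> Y \subset C -> (#|Y| <= #|X|)%N ->
  exists R1 : {set T}, [/\ R1 \subset C, #|R1| = #|R|,
    (R :\: X) :|: Y \subset R1 & (#|R :\: R1| <= #|X|)%N].
Proof.
move=> sRC sXR sYC leYX.
have [||R1 [s1 s2 c1]] := @subset_of_card T ((R :\: X) :|: Y) C #|R|.
- by rewrite subUset sYC andbT (subset_trans _ sRC) ?subsetDl.
- rewrite (subset_leq_card sRC) andbT (leq_trans (leq_card_setU _ _)) //.
  rewrite cardsD (setIidPr sXR).
  by have := subset_leq_card sXR; lia.
exists R1; split=> //; apply/subset_leq_card/subsetP => x.
rewrite inE => /andP [xR1 xR]; apply: contraR xR1 => xX.
by apply: (subsetP s1); rewrite !inE xX xR.
Qed.

(** * Facilities tagged with their colour *)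

Section TaggedFacilities.
Variables (T : finType) (F : bool -> {set T}).

(** The tag keeps apart the two copies of a point that is both a red and a blue facility. *)
Definition tagged_fac := {x : bool * T | x.2 \in F x.1}.
Definition color (s : tagged_fac) := (val s).1.
Definition place (s : tagged_fac) := (val s).2.

Lemma place_color_inj s s' : color s = color s' -> place s = place s' -> s = s'.
Proof.
move=> cs ps; apply/val_inj; move: cs ps; rewrite /color /place.
by case: (val s) => ? ?; case: (val s') => ? ? /= -> ->.
Qed.

Lemma placeP s : place s \in F (color s).
Proof. exact: (valP s). Qed.

Lemma tagged_facP b x : x \in F b -> {s | color s = b & place s = x}.
Proof. by move=> xF; exists (Sub (b, x) xF : tagged_fac). Qed.

Lemma card_tagged_fac (A : {set tagged_fac}) b :
  #|place @: [set s in A | color s == b]| = #|[set s in A | color s == b]|.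
Proof.
apply: card_in_imset => s s'; rewrite !inE => /andP [_ /eqP cs] /andP [_ /eqP cs'].
by apply: place_color_inj; rewrite cs.
Qed.

Lemma card_color_fac b : #|[set s : tagged_fac | color s == b]| = #|F b|.
Proof.
have -> : [set s : tagged_fac | color s == b] = [set s in setT | color s == b].
  by apply/setP => s; rewrite !inE.
rewrite -card_tagged_fac; apply: eq_card => x.
apply/imsetP/idP => [[s]|xF].
  by rewrite !inE => /eqP <- ->; apply: placeP.
have [s cs ps] := tagged_facP xF.
by exists s; rewrite ?inE ?cs /= ?eqxx.
Qed.

End TaggedFacilities.

(** * From instances to the abstract cost bound *)

Section Instance.
Variables (K : realType) (I : rb_instance K).
Implicit Types A : {set point I}.

Lemma cost_le A (f : point I -> point I) : (forall j, f j \in A) ->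
  (cost A <= (\sum_(j in clients I) dist (f j) j)%:E)%E.
Proof.
move=> fA; rewrite -sumEFin; apply: lee_sum => j _.
exact: (bigmin_le_cond _ (fun i => (dist i j)%:E) (fA j)).
Qed.

Lemma cost_fin A : A != set0 -> exists2 f : point I -> point I,
  forall j, f j \in A & cost A = (\sum_(j in clients I) dist (f j) j)%:E.
Proof.
case/set0Pn => x xA.
have h j := @eq_bigmin _ _ _ +oo%E x (mem A) (fun i => (dist i j)%:E) xA
  (fun i _ => leey _).
exists (fun j => s2val (h j)) => [j|]; first exact: (s2valP (h j)).
by rewrite -sumEFin; apply: eq_bigr => j _; apply: (s2valP' (h j)).
Qed.

Lemma local_opt_le (p q : nat) (R B R' B' : {set point I}) (c c' : K) :
    feasible R B -> feasible R' B' -> locally_optimum p R B ->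
    (0 < q)%N -> (2 * q.+1 <= p)%N -> R :|: B != set0 -> R' :|: B' != set0 ->
    cost (R :|: B) = c%:E -> cost (R' :|: B') = c'%:E ->
  (1 - q%:R^-1) * c <= (5 + 4 * q%:R^-1) * c'.
Proof.
move=> feas feas' lopt q0 qp ne ne' ec ec'.
case/and4P: (feas) => sR sB /eqP cR /eqP cB.
case/and4P: (feas') => sR' sB' /eqP cR' /eqP cB'.
(* Here [true] stands for red; [local_opt_cost] treats the two colours alike. *)
pose C b := if b then red_fac I else blue_fac I.
pose F b := if b then R else B; pose F' b := if b then R' else B'.
have FC b : F b \subset C b by case: b.
have FC' b : F' b \subset C b by case: b.
have fFU A A' (x : point I) : x \in A :|: A' -> {b : bool | x \in if b then A else A'}.
  by rewrite inE; case: (boolP (x \in A)) => [|_]; [exists true | exists false].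
have [f fA ef] := cost_fin ne; have [f' fA' ef'] := cost_fin ne'.
have hs j : {s : tagged_fac F | place s = f j}.
  by have [b xF] := fFU _ _ _ (fA j); have [s _ ps] := @tagged_facP _ F b _ xF; exists s.
have ho j : {s : tagged_fac F' | place s = f' j}.
  by have [b xF] := fFU _ _ _ (fA' j); have [s _ ps] := @tagged_facP _ F' b _ xF; exists s.
have eS : \sum_(j in clients I) dist (place (sval (hs j))) j
    = \sum_(j in clients I) dist (f j) j.
  by apply: eq_bigr => j _; rewrite (svalP (hs j)).
have -> : c = \sum_(j in clients I) dist (place (sval (hs j))) j.
  by rewrite eS; apply: EFin_inj; rewrite -ec.
have -> : c' = \sum_(j in clients I) dist (place (sval (ho j))) j.
  apply: EFin_inj; rewrite -ec' ef'; congr EFin; apply: eq_bigr => j _.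
  by rewrite (svalP (ho j)).
apply: (@local_opt_cost _ _ _ _ _ (@dist_ge0 _ I) (@dist_sym _ I)
  (@dist_triangle _ I) _ _ (@color _ F) (@color _ F')) => //.
  by move=> b; rewrite !card_color_fac /F /F'; case: b; rewrite ?cR ?cR' ?cB ?cB'.
move=> A A' g cA cAA' gA; rewrite eS.
(* Each colour is completed separately; the extra facilities cannot raise the cost. *)
have ex b : exists R1 : {set point I}, [/\ R1 \subset C b, #|R1| = #|F b|,
    (F b :\: (@place _ F @: [set s in A | color s == b]))
      :|: (@place _ F' @: [set o in A' | color o == b]) \subset R1
    & (#|F b :\: R1| <= p)%N].
  have sX : @place _ F @: [set s in A | color s == b] \subset F b.
    apply/subsetP => x /imsetP [s]; rewrite inE => /andP [_ /eqP <-] ->.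
    exact: placeP.
  have sY : @place _ F' @: [set s in A' | color s == b] \subset C b.
    apply: subset_trans (FC' b).
    apply/subsetP => x /imsetP [s]; rewrite inE => /andP [_ /eqP <-] ->.
    exact: placeP.
  have [|R1 [s1 c1 s2 c2]] := exchange_set (FC b) sX sY.
    by rewrite !card_tagged_fac.
  exists R1; split=> //; apply: leq_trans c2 _; rewrite card_tagged_fac.
  apply: leq_trans qp; apply: leq_trans cA; apply: subset_leq_card.
  by apply/subsetP => s; rewrite inE => /andP [].
have [R1 [sR1 cR1 gR1 dR1]] := ex true; have [B1 [sB1 cB1 gB1 dB1]] := ex false.
rewrite -lee_fin -ef; apply: le_trans (_ : cost (R1 :|: B1) <= _)%E.
  rewrite leNgt; apply/negP => lt; apply: lopt; exists R1, B1; split=> //.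
  by rewrite /feasible sR1 sB1 cR1 cB1 /= cR cB !eqxx.
apply: cost_le => j.
have inU b x : x \in (F b :\: (@place _ F @: [set s in A | color s == b]))
      :|: (@place _ F' @: [set o in A' | color o == b]) -> x \in R1 :|: B1.
  rewrite [in X in _ -> X]inE; case: b => h.
    by rewrite (subsetP gR1).
  by rewrite (subsetP gB1) ?orbT.
move: (gA j); rewrite inE => /orP [] /imsetP [s sA ->].
  apply: (inU (color s)); rewrite inE; apply/orP; left.
  rewrite inE placeP andbT; apply/imsetP => -[s']; rewrite inE => /andP [s'A /eqP cs] ps.
  by move: sA; rewrite (place_color_inj (esym cs) ps) inE s'A.
apply: (inU (color s)); rewrite inE; apply/orP; right.
by apply/imsetP; exists s => //; rewrite inE sA eqxx.
Qed.

End Instance.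

(** * Choice of the constants *)

Theorem theorem1 (K : realType) :
  exists (c : K) (p0 : nat),
    [/\ 0 < c,
        (1 <= p0)%N
      & forall p : nat, (p0 <= p)%N ->
        forall (I : rb_instance K) (R B : {set point I}),
          feasible R B ->
          locally_optimum p R B ->
          (cost (R :|: B) <= (5 + c / Num.sqrt p%:R)%:E * OPT I)%E].
Proof.
(* The error will be [9 / (q - 1)] with [q] about [p / 2]. For [p >= 10] one has
   [sqrt p <= p <= 4 * (q - 1)], whence [36 = 4 * 9]. *)
exists 36, 10%N; split=> // p p10 I R B feas lopt.
have s0 : 0 < Num.sqrt p%:R :> K by rewrite sqrtr_gt0 ltr0n; lia.
have [[R' B'] /= feas' ->] : {s : {set point I} * {set point I} | feasible s.1 s.2
    & OPT I = cost (s.1 :|: s.2)}.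
  apply: (@eq_bigmin _ _ _ +oo%E (R, B) (fun s => feasible s.1 s.2)
    (fun s => cost (s.1 :|: s.2))) => // s _; exact: leey.
have r0 : 0 <= 36 / Num.sqrt p%:R :> K by rewrite divr_ge0 ?ltW.
have cost_ge0 A : (0%E <= @cost K I A)%E.
  apply: sume_ge0 => j _; apply/bigmin_geP; split=> [|i _]; first exact: leey.
  by rewrite lee_fin dist_ge0.
case/and4P: (feas) => _ _ /eqP cR /eqP cB.
case/and4P: (feas') => _ _ /eqP cR' /eqP cB'.
(* If no facility may be opened, both solutions are empty and have the same, possibly infinite,
   cost. *)
have [U0|ne] := eqVneq (R :|: B) set0.
  have R0 : #|R| = 0%N by apply/eqP; rewrite cards_eq0 -subset0 -U0 subsetUl.
  have B0 : #|B| = 0%N by apply/eqP; rewrite cards_eq0 -subset0 -U0 subsetUr.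
  have -> : R' = set0 by apply: cards0_eq; rewrite cR' -cR.
  have -> : B' = set0 by apply: cards0_eq; rewrite cB' -cB.
  rewrite U0 setU0; apply: lee_pemull => //; rewrite lee_fin; lra.
have ne' : R' :|: B' != set0.
  apply: contraNneq ne => U0.
  have R0 : #|R'| = 0%N by apply/eqP; rewrite cards_eq0 -subset0 -U0 subsetUl.
  have B0 : #|B'| = 0%N by apply/eqP; rewrite cards_eq0 -subset0 -U0 subsetUr.
  have -> : R = set0 by apply: cards0_eq; rewrite cR -cR'.
  have -> : B = set0 by apply: cards0_eq; rewrite cB -cB'.
  by rewrite setU0.
have [f _ ec] := cost_fin ne; have [f' _ ec'] := cost_fin ne'.
(* The largest [q] with [2 * (q + 1) <= p]. *)
pose q := (p./2).-1.
have q0 : (0 < q)%N by rewrite /q; lia.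
have qp : (2 * q.+1 <= p)%N by rewrite /q; lia.
have := local_opt_le feas feas' lopt q0 qp ne ne' ec ec'.
have := cost_ge0 (R' :|: B').
rewrite ec ec' -EFinM !lee_fin.
set a := \sum_(j in _) dist (f j) j.
set b := \sum_(j in _) dist (f' j) j => b0 h.
have q1 : 1 < q%:R :> K by rewrite ltr1n /q; lia.
(* Multiplication by [q] gives the factor [5 * q + 4 = 5 * (q - 1) + 9]. *)
have h' : (q%:R - 1) * a <= (5 * (q%:R - 1) + 9) * b.
  have : q%:R * ((1 - q%:R^-1) * a) <= q%:R * ((5 + 4 * q%:R^-1) * b).
    by apply: ler_wpM2l.
  have qV : q%:R * q%:R^-1 = 1 :> K by rewrite mulfV // gt_eqF //; lra.
  rewrite !mulrA mulrBr (mulrDr _ 5) (mulrCA _ 4) qV !mulr1.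
  by congr (_ <= _ * b); lra.
have sq : Num.sqrt p%:R <= 4 * (q%:R - 1) :> K.
  apply: (@le_trans _ _ p%:R).
    have s1 : 1 <= Num.sqrt p%:R :> K.
      by rewrite -[leLHS]sqrtr1 ler_wsqrtr // ler1n; lia.
    rewrite -[leRHS]sqr_sqrtr ?ler0n // expr2.
    by apply: ler_peMr => //; apply: ltW.
  have -> : 4 * (q%:R - 1) = (4 * q.-1)%:R :> K.
    by rewrite natrM -subn1 natrB.
  by rewrite ler_nat /q; lia.
have le9 : 9 / (q%:R - 1) <= 36 / Num.sqrt p%:R :> K.
  rewrite ler_pdivrMr ?subr_gt0 // mulrAC ler_pdivlMr //; lra.
apply: (@le_trans _ _ ((5 + 9 / (q%:R - 1)) * b)); last first.
  by apply: ler_wpM2r => //; lra.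
rewrite -(@ler_pM2l _ (q%:R - 1)) ?subr_gt0 // mulrA; apply: le_trans h' _.
apply: ler_wpM2r => //; rewrite (mulrDr _ 5) (mulrCA _ 9) mulfV ?mulr1 ?subr_eq0 ?gt_eqF //.
lra.
Qed.
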